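(* Let $n \geq 2$ be an integer and let $Q_n$ be the $n$-dimensional hypercube graph. Then $b_1(Q_n) = \mathrm{CL}(Q_n) = n$.
   Context: All graphs are finite, simple and undirected. The hypercube $Q_n$ has vertex set the power set of $[n]=\{1,\dots,n\}$, with $u,v$ adjacent iff $|u\Delta v|=1$. Cooling number: initially all vertices of $G$ are uncooled. In each round, first every uncooled vertex with a cooled neighbor becomes cooled, then one uncooled vertex (if any remains) is chosen and cooled. $\mathrm{CL}(G)$ is the maximum, over all choices, of the number of rounds until all vertices are cooled (the round in which the last vertex becomes cooled is counted). $k$-liminal burning game on $G$ ($k$ a positive integer): two players, Saboteur and Arsonist. Each vertex is burned or unburned, and revealed or unrevealed; initially all are unburned and unrevealed. In each round: (i) propagation: every unburned vertex with a neighbor burned in an earlier round becomes burned (whether revealed or not); (ii) the Saboteur reveals $k$ vertices that are unrevealed and unburned (all such vertices if fewer than $k$ exist); revealed vertices stay revealed; (iii) the Arsonist burns one revealed unburned vertex (revealed in this or any earlier round), if one exists. The game ends in the round in which all vertices are burned. The Saboteur maximizes and the Arsonist minimizes the number of rounds; $b_k(G)$ is the number of rounds under optimal play. *)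

(* Defs.v *)
From mathcomp Require Import all_boot.
Set Implicit Arguments.
Unset Strict Implicit.
Unset Printing Implicit Defensive.

Record sgraph := SGraph {
  vertex :> finType;
  adj : rel vertex;
  adj_sym : symmetric adj;
  adj_irrefl : irreflexive adj
}.

Section Hypercube.
Variable n : nat.
Implicit Types u v : {set 'I_n}.

Definition symdiff u v := (u :\: v) :|: (v :\: u).

Definition hypercube_adj : rel {set 'I_n} := fun u v => #|symdiff u v| == 1.

Lemma hypercube_adj_sym : symmetric hypercube_adj.
Proof. by move=> u v; rewrite /hypercube_adj /symdiff setUC. Qed.

Lemma hypercube_adj_irrefl : irreflexive hypercube_adj.
Proof. by move=> u; rewrite /hypercube_adj /symdiff setDv setU0 cards0. Qed.

Definition hypercube := SGraph hypercube_adj_sym hypercube_adj_irrefl.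
End Hypercube.

Section Processes.
Variable G : sgraph.
Implicit Types A B C R X : {set G}.

Definition spread B := B :|: [set v | [exists u in B, adj u v]].

(* The possible results of adding to B one vertex of A that is not yet in B;
   B is left unchanged only when there is no such vertex. *)
Definition add_one A B : {set {set G}} :=
  if A \subset B then [set B] else [set x |: B | x in A :\: B].

(* Maximal number of further rounds when the vertices of C are cooled.  The
   value does not depend on the fuel t once t >= #|~: C| (cool_rounds_fuel). *)
Fixpoint cool_rounds t C : nat :=
  if t is t'.+1 then
    if C == setT then 0
    else (\max_(C' in add_one setT (spread C)) cool_rounds t' C').+1
  else 0.

Definition cooling_number := cool_rounds #|[set: G]| set0.

(* The possible sets of revealed vertices after the Saboteur's move, B being
   the set of burned vertices and R the set of revealed ones. *)
Definition reveal k B R : {set {set G}} :=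
  [set R :|: X | X : {set G} &
     (X \subset ~: (R :|: B)) && (#|X| == minn k #|~: (R :|: B)|)].

(* Minimax number of further rounds when the vertices of B are burned and those
   of R are revealed.  For k > 0, the value does not depend on the fuel t once
   t >= #|~: B| (burn_rounds_fuel).  The maximum and the minimum range over
   nonempty sets (reveal_neq0, add_one_neq0); the default value #|[set: G]| of
   the minimum is never smaller than the numbers compared (burn_rounds_le). *)
Fixpoint burn_rounds k t B R : nat :=
  if t is t'.+1 then
    if B == setT then 0
    else (\max_(R' in reveal k (spread B) R)
           \big[minn/#|[set: G]|]_(B' in add_one R' (spread B))
             burn_rounds k t' B' R').+1
  else 0.

(* Meaningful for k > 0 only. *)
Definition liminal_burning_number k := burn_rounds k #|[set: G]| set0 set0.

Lemma add_one_neq0 A B : add_one A B != set0.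
Proof.
rewrite /add_one; case: ifPn => [_|/subsetPn[x xA xB]].
  by apply/set0Pn; exists B; rewrite set11.
by apply/set0Pn; exists (x |: B); apply: imset_f; rewrite inE xB.
Qed.

Lemma reveal_neq0 k B R : reveal k B R != set0.
Proof.
have /card_geqP[s [us ss sU]] := geq_minr k #|~: (R :|: B)|.
apply/set0Pn; exists (R :|: [set x in s]); apply: imset_f.
rewrite inE cardsE (card_uniqP us) ss eqxx andbT.
by apply/subsetP => x; rewrite inE => /sU.
Qed.

Lemma add_one_lt A B C : B != setT ->
  (spread B != setT -> ~~ (A \subset spread B)) ->
  C \in add_one A (spread B) -> #|~: C| < #|~: B|.
Proof.
move=> BnT AB CA; apply: proper_card; rewrite properC.
have BS : B \subset spread B by apply: subsetUl.
have [ST|SnT] := eqVneq (spread B) setT.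
  by move: CA; rewrite /add_one ST subsetT inE => /eqP ->; rewrite properT.
move: CA; rewrite /add_one (negPf (AB SnT)) => /imsetP[x].
rewrite inE => /andP[xS _] ->; apply: (sub_proper_trans BS).
by rewrite properE subsetUr subUset sub1set (negPf xS).
Qed.

Lemma reveal_unburned k B R R' : 0 < k -> R' \in reveal k B R ->
  B != setT -> ~~ (R' \subset B).
Proof.
move=> k0 /imsetP[X]; rewrite inE => /andP[sX cX] -> BnT.
apply/negP; rewrite subUset => /andP[RB XB].
move: sX cX; rewrite (setUidPr RB) => sX.
have -> : X = set0.
  by apply/setP=> x; rewrite inE; apply/negP => xX;
     move/subsetP/(_ _ xX): sX; rewrite inE (subsetP XB _ xX).
rewrite cards0 => /eqP m0.
have : 0 < minn k #|~: B|.
  by rewrite leq_min k0 card_gt0 -setCT (inj_eq (@setC_inj _)).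
by rewrite -m0.
Qed.

Lemma cool_rounds_fuel t C : #|~: C| <= t ->
  cool_rounds t C = cool_rounds #|~: C| C.
Proof.
have [m] := ubnP #|~: C|; elim: m t C => // m IH [|t] C ltm.
  by rewrite leqn0 => /eqP ->.
move=> let_t; have [->|CnT] := eqVneq C setT.
  by rewrite setCT cards0 /= eqxx.
have: 0 < #|~: C| by rewrite card_gt0 -setCT (inj_eq (@setC_inj _)).
case E: #|~: C| => [//|c] _ /=; rewrite (negPf CnT); congr _.+1.
apply: eq_bigr => D CD; have ltD : #|~: D| < c.+1.
  by rewrite -E; apply: add_one_lt CD => // SnT; rewrite subTset.
rewrite ltnS in ltD; have ltDm : #|~: D| < m.
  by apply: leq_ltn_trans ltD _; rewrite -E.
by rewrite IH ?[RHS]IH // (leq_trans ltD) // -ltnS -E.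
Qed.

Lemma burn_rounds_fuel k t B R : 0 < k -> #|~: B| <= t ->
  burn_rounds k t B R = burn_rounds k #|~: B| B R.
Proof.
move=> k0; have [m] := ubnP #|~: B|; elim: m t B R => // m IH [|t] B R ltm.
  by rewrite leqn0 => /eqP ->.
move=> let_t; have [->|BnT] := eqVneq B setT.
  by rewrite setCT cards0 /= eqxx.
have: 0 < #|~: B| by rewrite card_gt0 -setCT (inj_eq (@setC_inj _)).
case E: #|~: B| => [//|c] _ /=; rewrite (negPf BnT); congr _.+1.
apply: eq_bigr => R' RR'; apply: eq_bigr => D BD.
have ltD : #|~: D| < c.+1.
  by rewrite -E; apply: add_one_lt BD => //; apply: reveal_unburned RR'.
rewrite ltnS in ltD; have ltDm : #|~: D| < m.
  by apply: leq_ltn_trans ltD _; rewrite -E.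
by rewrite IH ?[RHS]IH // (leq_trans ltD) // -ltnS -E.
Qed.

Lemma burn_rounds_le k t B R : burn_rounds k t B R <= t.
Proof.
elim: t B R => //= t IH B R; case: ifP => // _; rewrite ltnS.
apply/bigmax_leqP => R' _; have [D DA] := set0Pn _ (add_one_neq0 R' (spread B)).
apply: leq_trans (IH D R'); have := mem_index_enum D.
elim: (index_enum _) => // E s IHs; rewrite big_cons inE.
case/predU1P => [<-|/IHs le_s]; first by rewrite DA geq_minl.
by case: ifP => // _; apply: leq_trans le_s; apply: geq_minr.
Qed.
End Processes.

(* Main.v *)
(* The one vertex that the Saboteur reveals is always the one that the Arsonist
   must burn, so the 1-liminal burning game is the cooling process on every
   graph.  On Q_n, the first cooled vertex v has its ball of radius n - 1 cooled
   by the propagation of round n, which leaves at most the antipode of v to be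
   cooled in that round.  Conversely, cool the empty set and then, in rounds
   2, ..., n - 1, the members of an antichain v_2, ..., v_(n-1) with #|v_i| = i:
   after round i the cooled sets of size i all contain some v_j and there are
   none of larger size, so v_(i+1) is available and [n] is uncooled after round
   n - 1. *)
Require Import Defs.
From mathcomp Require Import all_boot.
Set Implicit Arguments.
Unset Strict Implicit.
Unset Printing Implicit Defensive.

(** * Cooling and 1-liminal burning on an arbitrary graph *)

Section Processes.
Variable G : sgraph.
Implicit Types B C R : {set G}.

Lemma in_spread B u :
  u \in spread B -> u \in B \/ exists2 w, w \in B & adj w u.
Proof.
rewrite !inE => /orP[|/exists_inP[w wB wu]]; [by left | by right; exists w].
Qed.

Lemma spread_adj B u w : w \in B -> adj w u -> u \in spread B.
Proof.
by move=> wB wu; rewrite !inE; apply/orP; right; apply/exists_inP; exists w.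
Qed.

Lemma spread_set0 : spread (set0 : {set G}) = set0.
Proof.
by apply/setP=> u; rewrite [RHS]inE; apply/negP => /in_spread[|[w]]; rewrite inE.
Qed.

Lemma cool_rounds_setT t : cool_rounds t [set: G] = 0.
Proof. by case: t => //= t; rewrite eqxx. Qed.

Lemma cool_rounds_add t C x : C != setT -> x \notin spread C ->
  cool_rounds t (x |: spread C) < cool_rounds t.+1 C.
Proof.
move=> CnT xC; rewrite /= (negPf CnT) ltnS.
apply: (leq_bigmax_cond (x |: spread C)).
rewrite /add_one subTset; case: eqP => [sT|_]; first by rewrite sT inE in xC.
by apply: imset_f; rewrite inE xC inE.
Qed.

Lemma reveal1 B R : R \subset B -> B != setT ->
  reveal 1 B R = [set x |: R | x in ~: B].
Proof.
move=> /setUidPr RB BnT.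
have m1 : minn 1 #|~: B| = 1.
  by apply/minn_idPl; rewrite card_gt0 -setCT (inj_eq (@setC_inj _)).
apply/setP=> S; rewrite /reveal RB m1; apply/imsetP/imsetP => [[X]|[x xB ->]].
  rewrite inE => /andP[XB /cards1P[x defX]] ->; exists x; last by rewrite defX setUC.
  by move: XB; rewrite defX sub1set.
by exists [set x]; rewrite 1?setUC // inE sub1set xB cards1.
Qed.

Lemma add_one1 A B x : A :\: B = [set x] -> add_one A B = [set x |: B].
Proof.
by move=> AB; rewrite /add_one -setD_eq0 AB -cards_eq0 cards1 imset_set1.
Qed.

Lemma bigmin_set1 m (F : {set G} -> nat) B : F B <= m ->
  \big[minn/m]_(C in [set B]) F C = F B.
Proof.
move=> FB; rewrite (eq_bigl (pred1 B)); last by move=> C; rewrite inE.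
rewrite -big_filter filter_pred1_uniq ?index_enum_uniq ?mem_index_enum //.
by rewrite big_seq1_id; apply/minn_idPl.
Qed.

(** The invariant [R \subset B] persists: only the vertex just revealed is revealed and unburned, so
    the minimum has a single term. The bound on [t] keeps the default value of that minimum above
    this term. *)
Lemma burn_rounds1_cool t B R : R \subset B -> t <= #|[set: G]| ->
  burn_rounds 1 t B R = cool_rounds t B.
Proof.
elim: t B R => //= t IH B R RB let_t; case: ifP => // _; congr _.+1.
have let_t' := ltnW let_t.
have RS : R \subset spread B by apply: subset_trans RB (subsetUl _ _).
have [ST|SnT] := eqVneq (spread B) setT.
  have AT A : add_one A [set: G] = [set setT] by rewrite /add_one subsetT.
  have rT : reveal 1 (spread B) R = [set R].
    rewrite /reveal ST setUT setCT cards0 minn0; apply/setP => S.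
    rewrite inE; apply/imsetP/eqP => [[X]|->].
      by rewrite inE cards_eq0 => /andP[_ /eqP->] ->; rewrite setU0.
    by exists set0; rewrite ?setU0 // inE sub0set cards0.
  rewrite rT ST AT !big_set1 AT bigmin_set1 ?IH ?subsetT //.
  by rewrite -(IH _ R) ?subsetT // (leq_trans (burn_rounds_le _ _ _ _)).
rewrite reveal1 // /add_one subTset (negPf SnT) setTD.
(* Both maxima are reindexed by the vertex [x] outside [spread B], with [D] being [R] on one side
   and [spread B] on the other, and then compared term by term. *)
have inj_add (D : {set G}) :
    D \subset spread B -> {in ~: spread B &, injective (fun x => x |: D)}.
  move=> /subsetP DS x y; rewrite in_setC => /negP xS _ /setP/(_ x).
  by rewrite in_setU1 eqxx in_setU1 => /esym/orP[/eqP|/DS].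
rewrite !big_imset; try exact: inj_add.
apply: eq_bigr => x xS /=.
have AB : (x |: R) :\: spread B = [set x].
  rewrite setDUl (eqP (_ : R :\: _ == set0)) ?setD_eq0 // setU0.
  by apply/setDidPl; rewrite disjoints1 -in_setC.
rewrite -/(add_one _ _) (add_one1 AB) bigmin_set1 ?IH ?setUS //.
by rewrite -(IH _ set0) ?sub0set // (leq_trans (burn_rounds_le _ _ _ _)).
Qed.

Lemma liminal_burning_number1 : liminal_burning_number G 1 = cooling_number G.
Proof. by apply: burn_rounds1_cool; rewrite ?sub0set. Qed.

End Processes.

(** * Balls and antichains in the hypercube *)

Section Hypercube.
Variable n : nat.
Implicit Types (u v w : {set 'I_n}) (C : {set hypercube n}).

Lemma in_symdiff u v x : (x \in symdiff u v) = (x \in u) (+) (x \in v).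
Proof. by rewrite !inE; case: (x \in u); case: (x \in v). Qed.

Lemma symdiffP u v : symdiff u v = set0 -> u = v.
Proof.
move=> /setP uv; apply/setP=> x; move: (uv x); rewrite in_symdiff inE.
by case: (x \in u); case: (x \in v).
Qed.

Lemma symdiff_setT u v : symdiff u v = setT -> v = ~: u.
Proof.
move=> /setP uv; apply/setP=> x; move: (uv x); rewrite in_symdiff !inE.
by case: (x \in u); case: (x \in v).
Qed.

Lemma hypercube_adj_closer v u d : #|symdiff v u| = d.+1 ->
  exists2 w, #|symdiff v w| = d & hypercube_adj w u.
Proof.
move=> vu; have /card_gt0P[x xvu] : 0 < #|symdiff v u| by rewrite vu.
exists (symdiff u [set x]).
  have -> : symdiff v (symdiff u [set x]) = symdiff v u :\ x.
    apply/setP=> y; rewrite in_setD1 !in_symdiff inE.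
    case: eqP => [->|_]; last by rewrite addbF.
    by move: xvu; rewrite in_symdiff; case: (x \in v); case: (x \in u).
  by move: vu; rewrite (cardsD1 x) xvu => -[].
rewrite /hypercube_adj (_ : symdiff _ u = [set x]) ?cards1 //.
by apply/setP=> y; rewrite !in_symdiff addbAC addbb addFb.
Qed.

Lemma hypercube_adj_cases u w : hypercube_adj u w ->
  (#|w| < #|u|) \/ (u \subset w /\ #|w| = #|u|.+1).
Proof.
move=> /cards1P[x /setP uw].
have E y : y \in w = (y == x) (+) (y \in u).
  by move: (uw y); rewrite in_symdiff inE => <-; case: (y \in u); case: (y \in w).
have [xu|xu] := boolP (x \in u); [left|right].
  apply/proper_card/properP; split; last by exists x; rewrite // E eqxx xu.
  by apply/subsetP => y; rewrite E; case: eqP => // ->.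
have -> : w = x |: u.
  by apply/setP=> y; rewrite E !inE; case: eqP => // ->; rewrite (negPf xu).
by rewrite subsetUr cardsU1 xu.
Qed.

(** One propagation enlarges the radius of a cooled ball from [n - s - 1] to [n - s]; [s < n] puts
    the centre itself in the smaller ball. *)
Lemma spread_ball v s C : s < n ->
  (forall u, #|symdiff v u| + s < n -> u \in C) ->
  forall u, #|symdiff v u| + s <= n -> u \in spread C.
Proof.
move=> lt_sn ballC u; case E: #|symdiff v u| => [|d].
  by move=> _; apply: (subsetP (subsetUl _ _)); apply: ballC; rewrite E.
have [w vw wu] := hypercube_adj_closer E.
move=> ltd; apply: (@spread_adj (hypercube n) C u w) wu.
by apply: ballC; rewrite vw.
Qed.

Lemma cool_rounds_ball v s t C : s.+1 < n ->
  (forall u, #|symdiff v u| + s.+1 < n -> u \in C) -> cool_rounds t C <= s.+1.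
Proof.
elim: s t C => [|s IH] [|t] C lt_sn ballC //=; case: ifP => // _;
  rewrite ltnS; apply/bigmax_leqP => C' C'C.
(* Here the ball has radius [n - 2], and [n - 1] after propagation: any vertex left to choose is the
   antipode of [v], and cooling it finishes. *)
- suff -> : C' = setT by rewrite cool_rounds_setT.
  move: C'C; rewrite /add_one subTset; case: eqP => [-> /set1P //|_].
  move=> /imsetP[x]; rewrite inE => /andP[xS _] ->; apply/setP=> u.
  rewrite in_setU1 [RHS]inE; have antipode w : w \notin spread C -> w = ~: v.
    move=> wS; apply: symdiff_setT; apply/eqP; rewrite eqEcard subsetT.
    rewrite cardsT card_ord leqNgt; apply: contra wS => ltw.
    by apply: (spread_ball lt_sn ballC); rewrite addn1.
  have [_|/antipode ->] := boolP (u \in spread C); first by rewrite orbT.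
  by rewrite (antipode x xS) eqxx.
- apply: IH => [|u ltu]; first exact: ltnW.
  have uS : u \in spread C by apply: (spread_ball lt_sn ballC); rewrite addnS.
  move: C'C; rewrite /add_one; case: ifP => [_ /set1P -> //|_].
  by case/imsetP=> x _ ->; rewrite in_setU1 uS orbT.
Qed.

(* What the strategy of cooling set0, v 2, v 3, ... keeps true after round i. *)
Definition cooled_upto (v : nat -> {set 'I_n}) i C :=
  forall u, u \in C ->
    #|u| < i \/ #|u| = i /\ exists2 j, 1 < j <= i & v j \subset u.

Lemma cool_rounds_antichain (v : nat -> {set 'I_n}) i t C :
  (forall j, 1 < j < n -> #|v j| = j) ->
  (forall j k, 1 < j -> j < k < n -> ~~ (v j \subset v k)) ->
  0 < i < n -> n - i <= t -> cooled_upto v i C -> n - i <= cool_rounds t C.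
Proof.
move=> card_v anti_v; elim: t i C => [//|t IH] i C /andP[i0 lt_in] le_t inv.
have CnT : C != setT.
  apply/negP => /eqP CT; have := inv [set: 'I_n].
  rewrite CT inE cardsT card_ord => /(_ isT)[|[eq_ni _]].
    by rewrite ltnNge ltnW.
  by rewrite eq_ni ltnn in lt_in.
have invS u : u \in spread C ->
    #|u| < i.+1 \/ #|u| = i.+1 /\ exists2 j, 1 < j <= i & v j \subset u.
  case/in_spread => [/inv[/ltnW|[-> _]]|[w /inv wC /hypercube_adj_cases wu]].
  - by left.
  - by left.
  case: wu => [ltu|[sub_wu ->]].
    left; apply: ltn_trans ltu _; rewrite ltnS.
    by case: wC => [/ltnW|[-> _]].
  case: wC => [|[-> [j ij vw]]]; first by left.
  by right; split=> //; exists j => //; apply: subset_trans sub_wu.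
(* If [i = n - 1], one round is owed, and it takes place because [C] is not everything. *)
have [lt_i1n|ge_i1n] := ltnP i.+1 n; last first.
  by rewrite /= (negPf CnT) (leq_trans (leq_sub2r i ge_i1n)) // subSnn.
have vi : #|v i.+1| = i.+1 by rewrite card_v // ltnS i0.
(* By [invS], a cooled set of this size would contain an earlier [v j], against the antichain
   property. *)
have viS : v i.+1 \notin spread C.
  apply/negP => /invS[|[_ [j /andP[j1 ji]]]]; first by rewrite vi ltnn.
  by apply/negP/anti_v; rewrite // ltnS ji.
apply: leq_trans (cool_rounds_add t CnT viS).
rewrite -(subnSK lt_in) ltnS; apply: IH => //.
  by rewrite subnS -ltnS prednK ?subn_gt0.
move=> u /setU1P[->|/invS[|[ui [j /andP[j1 ji] vj]]]]; [right|by left|right].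
  by split=> //; exists i.+1; rewrite // ltnS i0 leqnn.
by split=> //; exists j; rewrite // j1 ltnW.
Qed.

End Hypercube.

(* From sets w_k of [n], take on [n + 1] the complements of {n + 1} and of the
   w_k: the former is incomparable with the others, which all contain n + 1. *)
Lemma antichain_each_card n : exists v : nat -> {set 'I_n},
  (forall j, 1 < j < n -> #|v j| = j) /\
  (forall j k, 1 < j -> j < k < n -> ~~ (v j \subset v k)).
Proof.
elim: n => [|n [w [card_w anti_w]]].
  by exists (fun=> set0); split=> [j|j k _]; rewrite ltn0 andbF.
(* [c k] is the complement of the new member of size [n.+1 - k]. The sets [w k] are only controlled
   for [k > 1], so [ord_max] supplies size 1. *)
pose c k : {set 'I_n.+1} :=
  if k == 1 then [set ord_max] else lift ord_max @: w k.
have card_c k : 0 < k < n -> #|c k| = k.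
  rewrite /c; case: eqP => [-> _|/eqP k1 /andP[k0 kn]]; first exact: cards1.
  rewrite card_imset; last exact: lift_inj.
  by rewrite card_w // kn andbT ltn_neqAle eq_sym k1.
have sub_lt j : 1 < j < n.+1 -> n.+1 - j < n.
  by case: j => [|[|j]] // jn; rewrite subSS ltn_subrL (leq_trans _ (jn : j.+1 < n)).
exists (fun j => ~: c (n.+1 - j)); split=> [j lt_jn|j k j1 /andP[jk kn]].
  have /andP[_ jn] := lt_jn.
  have cj : 0 < n.+1 - j < n by rewrite subn_gt0 jn sub_lt.
  by rewrite cardsCs setCK card_ord card_c // subKn // ltnW.
have k0 : 0 < n.+1 - k by rewrite subn_gt0.
have lt_kj : n.+1 - k < n.+1 - j by rewrite ltn_sub2l // (ltn_trans jk).
(* Complementation reverses the inclusion, and of the two indices only the smaller, [n.+1 - k], can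
   be 1. *)
rewrite setCS /c (gtn_eqF (leq_ltn_trans k0 lt_kj)).
case: eqP => [_|/eqP k1].
  rewrite sub1set; apply/imsetP => -[x _ /eqP]; apply/negP; exact: neq_lift.
have /subsetPn[x xk xj] : ~~ (w (n.+1 - k) \subset w (n.+1 - j)).
  apply: anti_w; first by rewrite ltn_neqAle eq_sym k1.
  by rewrite lt_kj sub_lt // j1 (ltn_trans jk).
apply/subsetPn; exists (lift ord_max x); first exact: imset_f.
by rewrite mem_imset //; apply: lift_inj.
Qed.

Lemma cooling_number_hypercube n : 1 < n -> cooling_number (hypercube n) = n.
Proof.
move=> n1; rewrite /cooling_number.
(* The fuel [2 ^ n] exceeds [n], so after the first round at least [n - 1] units remain for the
   lower bound. *)
have := ltn_expl n (isT : 1 < 2).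
have -> : 2 ^ n = #|[set: hypercube n]|.
  by rewrite -powersetT card_powerset cardsT card_ord.
case: #|_| => // t; rewrite ltnS => le_nt.
have n0T : (set0 : {set hypercube n}) != setT.
  by apply/negP => /eqP/setP/(_ set0); rewrite !inE.
apply/eqP; rewrite eqn_leq; apply/andP; split.
  (* Upper bound: the first round cools some [v], a ball of radius 0, which leaves at most [n - 1]
     rounds. *)
  rewrite /= (negPf n0T) spread_set0.
  case: n n1 {le_nt n0T} => [|[|s]] // _; rewrite ltnS; apply/bigmax_leqP => C.
  rewrite /add_one subset0 -cards_eq0 cardsT.
  case: ifP => [/eqP T0|_ /imsetP[v _ ->]].
    by have := max_card (pred1 (set0 : hypercube s.+2)); rewrite T0 card1.
  apply: (cool_rounds_ball (v := v)) => // u.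
  rewrite -[X in _ < X]add1n ltn_add2r ltnS leqn0 cards_eq0.
  by move=> /eqP/symdiffP <-; rewrite in_setU1 eqxx.
have [v [card_v anti_v]] := antichain_each_card n.
(* Lower bound: the first vertex cooled is the empty set, and the antichain strategy starts from
   [i = 1]. *)
have := @cool_rounds_add (hypercube n) t set0 set0 n0T; rewrite spread_set0 inE setU0.
move=> /(_ isT); apply: leq_trans.
rewrite -[X in X <= _](prednK (ltnW n1)) ltnS -subn1.
apply: (cool_rounds_antichain card_v anti_v) => [//||u /set1P ->].
  by rewrite leq_subLR (leq_trans le_nt) ?leq_addl.
by left; rewrite cards0.
Qed.

Theorem theorem3 (n : nat) (hn : 2 <= n) :
  liminal_burning_number (hypercube n) 1 = cooling_number (hypercube n) /\
  cooling_number (hypercube n) = n.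
Proof.
split; first exact: liminal_burning_number1.
exact: cooling_number_hypercube.
Qed.
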